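(* The ring $\mathcal{W}_{\mathbb{Z}^2}[T_{(1,1)}^{-1},T_{(1,0)}^{-1},T_{(0,1)}^{-1}]$ is generated as a $\mathbb{Z}$-algebra by the eleven elements $$T_{(1,1)},\ T_{(1,0)},\ T_{(0,1)},\ T_{(1,1)}^{-1},\ T_{(1,0)}^{-1},\ T_{(0,1)}^{-1},\ T_{(2,1)},\ T_{(1,2)},\ T_{(2,0)},\ T_{(0,2)},\ T_{(2,2)},$$ and the following identities hold: $$T_{(1,-1)}T_{(1,1)}^3=T_{(1,0)}^3T_{(1,2)}-T_{(0,1)}^3T_{(2,1)},$$ $$T_{(2,2)}T_{(1,-1)}T_{(1,0)}T_{(0,1)}=T_{(1,1)}\left(T_{(0,2)}T_{(2,1)}T_{(1,0)}-T_{(0,1)}T_{(2,0)}T_{(1,2)}\right).$$ In particular, if $W:\mathbb{Z}^2\to\mathbb{Q}$ is an elliptic net for which 1. $W(1,0)=W(0,1)=W(1,1)=1$, 2. $W(2,0)$, $W(0,2)$, $W(1,2)$, $W(2,1)$ are integers with $W(1,2)\neq W(2,1)$, and 3. $W(1,2)-W(2,1)$ divides $W(0,2)W(2,1)-W(2,0)W(1,2)$, then all terms of the elliptic net are determined by these seven values and are integers.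
   Context: For a finitely generated free abelian group $A$ and an integral domain $R$, an elliptic net is a map $W:A\to R$ with $W(0)=0$ and, for all $p,q,r,s\in A$, $$W(p+q+s)W(p-q)W(r+s)W(r)+W(q+r+s)W(q-r)W(p+s)W(p)+W(r+p+s)W(r-p)W(q+s)W(q)=0.$$ For a free finitely generated abelian group $I$, let $\mathcal{M}$ be the ideal of the polynomial ring $\mathbb{Z}[T_i]_{i\in I}$ generated by $T_0$ and all polynomials $$T_{p+q+s}T_{p-q}T_{r+s}T_r+T_{q+r+s}T_{q-r}T_{p+s}T_p+T_{r+p+s}T_{r-p}T_{q+s}T_q\qquad(p,q,r,s\in I).$$ $\mathcal{W}_I$ denotes the quotient of $\mathbb{Z}[T_i]_{i\in I}/\mathcal{M}$ by its nilradical. (Thus elliptic nets $I\to R$ correspond to ring homomorphisms $\mathcal{W}_I\to R$, $T_i\mapsto W(i)$.) Square brackets with inverses denote localization. *)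

(* Defs.v *)
From HB Require Import structures.
From mathcomp Require Import all_boot all_order all_algebra.
From mathcomp Require Import ring.
From mathcomp Require Import boolp.
From mathcomp Require Import monalg.

Set Implicit Arguments.
Unset Strict Implicit.
Unset Printing Implicit Defensive.

Import GRing.Theory.
Local Open Scope ring_scope.
Local Open Scope quotient_scope.

Definition net_expr (A : zmodType) (R : comPzRingType) (W : A -> R)
    (p q r s : A) : R :=
    W (p + q + s) * W (p - q) * W (r + s) * W r
  + W (q + r + s) * W (q - r) * W (p + s) * W p
  + W (r + p + s) * W (r - p) * W (q + s) * W q.

(* Freeness and finite generation of A play no role in the equations; they are
   supplied by the instance Z2 below. *)
Definition elliptic_net (A : zmodType) (R : idomainType) (W : A -> R) : Prop :=
  W 0 = 0 /\ forall p q r s : A, net_expr W p q r s = 0.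

Lemma rmorph_net_expr (A : zmodType) (R S : comPzRingType) (f : {rmorphism R -> S})
    (W : A -> R) p q r s :
  f (net_expr W p q r s) = net_expr (f \o W) p q r s.
Proof. by rewrite /net_expr !rmorphD !rmorphM. Qed.

Lemma net_expr0 (A : zmodType) (R : comPzRingType) (W : A -> R) p q r s :
  W =1 (fun=> 0) -> net_expr W p q r s = 0.
Proof. by move=> W0; rewrite /net_expr !W0 !mulr0 !addr0. Qed.

Definition ideal_span (R : comNzRingType) (G : R -> Prop) : {pred R} :=
  fun x => `[< exists2 s : seq (R * R),
                 (forall c, c \in s -> G c.2)
               & x = \sum_(c <- s) c.1 * c.2 >].

Lemma ideal_span_closed (R : comNzRingType) (G : R -> Prop) :
  ~~ (1 \in ideal_span G) -> idealr_closed (ideal_span G).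
Proof.
move=> n1; split=> //.
  by apply/asboolP; exists [::]; rewrite ?big_nil.
move=> a _ _ /asboolP[s sG ->] /asboolP[t tG ->]; apply/asboolP.
exists ([seq (a * c.1, c.2) | c <- s] ++ t).
  move=> c; rewrite mem_cat => /orP[/mapP[d /sG ? ->] //|]; exact: tG.
rewrite big_cat big_map mulr_sumr; congr (_ + _).
by apply: eq_bigr => c _; rewrite mulrA.
Qed.

Definition nilradical (R : comNzRingType) : {pred R} :=
  fun x => `[< exists n : nat, x ^+ n = 0 >].
Arguments nilradical R : clear implicits.

Lemma nilradical_closed (R : comNzRingType) : idealr_closed (nilradical R).
Proof.
split.
- by apply/asboolP; exists 1%N.
- by apply/asboolPn=> -[n]; rewrite expr1n => /eqP; rewrite oner_eq0.
move=> a x y /asboolP[m xm] /asboolP[n yn]; apply/asboolP.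
exists (m + n)%N; rewrite exprDn big1 // => -[i /= lei] _.
have [lt_in|le_ni] := ltnP i n; last first.
  by rewrite -[in y ^+ i](subnK le_ni) exprD yn !mulr0 mul0rn.
have le_m : (m <= m + n - i)%N by rewrite -addnBA ?leq_addr // ltnW.
by rewrite exprMn -(subnK le_m) [x ^+ _]exprD xm !mulr0 mul0r mul0rn.
Qed.

HB.instance Definition _ (R : comNzRingType) :=
  isIdealr.Build R (nilradical R) (nilradical_closed R).

Definition reduced_quot (R : comNzRingType) : comNzRingType :=
  {ideal_quot (nilradical R : idealr R)}.

Section NetRing.
Variable I : zmodType.

Definition poly_ring : comNzRingType := {malg int[{cmonom I}]}.
Definition poly_var (i : I) : poly_ring := << (ucm i : {cmonom I}) >>.

Definition net_gen (f : poly_ring) : Prop :=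
  f = poly_var 0 \/ exists p q r s : I, f = net_expr poly_var p q r s.

Definition net_ideal : {pred poly_ring} := ideal_span net_gen.

(* The ideal is proper: it lies in the kernel of the map sending every variable
   to 0. *)
Lemma net_ideal_closed : idealr_closed net_ideal.
Proof.
pose ev : {rmorphism poly_ring -> int} :=
  (@mcoeff {cmonom I} int (mone : {cmonom I}) : {rmorphism {malg int[{cmonom I}]} -> int}).
have var0 i : ev (poly_var i) = 0.
  rewrite /= mcoeffU; case: (cmP (ucm i) mone) => // /(_ i).
  by rewrite cmU cm1 eqxx.
apply: ideal_span_closed; apply/asboolPn => -[s sG] /(congr1 ev).
rewrite rmorph1 raddf_sum big_seq big1 => [/eqP|c /sG]; first by rewrite oner_eq0.
rewrite -[LHS]/(ev (c.1 * c.2)) rmorphM => -[->|[p [q [u [v ->]]]]].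
  by rewrite var0 mulr0.
by rewrite (rmorph_net_expr ev poly_var) (net_expr0 _ _ _ _ var0) mulr0.
Qed.

HB.instance Definition _ := isIdealr.Build poly_ring net_ideal net_ideal_closed.

Definition net_quot : comNzRingType := {ideal_quot (net_ideal : idealr poly_ring)}.
Definition net_ring : comNzRingType := reduced_quot net_quot.
Definition net_var (i : I) : net_ring := \pi_net_ring (\pi_net_quot (poly_var i)).

End NetRing.

Definition powers_of (R : comPzRingType) (s : seq R) : {pred R} :=
  fun x => `[< exists e : nat -> nat, x = \prod_(i < size s) s`_i ^+ e i >].

Lemma powers_of_closed (R : comPzRingType) (s : seq R) :
  mulr_closed (powers_of s).
Proof.
split; first by apply/asboolP; exists (fun=> 0%N); rewrite big1.
move=> _ _ /asboolP[d ->] /asboolP[e ->]; apply/asboolP.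
exists (fun i => (d i + e i)%N); rewrite -big_split.
by apply: eq_bigr => i _; rewrite exprD.
Qed.

HB.instance Definition _ (R : comPzRingType) (s : seq R) :=
  GRing.isMulClosed.Build R (powers_of s) (powers_of_closed s).

Lemma mem_powers_of (R : comPzRingType) (s : seq R) x :
  x \in s -> x \in powers_of s.
Proof.
move=> xs; apply/asboolP; exists (fun i => (i == index x s) : nat).
have lt_xs : (index x s < size s)%N by rewrite index_mem.
rewrite (bigD1 (Ordinal lt_xs)) //= eqxx expr1 nth_index // big1 ?mulr1 // => i.
by rewrite -val_eqE /= => /negPf->.
Qed.

Module Localization.
Section Localization.
Variables (R : comPzRingType) (S : mulrClosed R).

Definition pre : Type := (R * {x : R | x \in S})%type.
HB.instance Definition _ := Choice.on pre.

Implicit Types x y z : pre.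
Local Notation num x := (x.1).
Local Notation den x := (sval x.2).

(* The extra factor u is needed since S may contain zero divisors. The zero ring
   is allowed (comPzRingType), so no assumption on S is necessary. *)
Definition equiv x y : bool :=
  `[< exists2 u, u \in S & u * (num x * den y) = u * (num y * den x) >].

Lemma equiv_is_equiv : equiv_class_of equiv.
Proof.
split=> [x|x y|y x z].
- by apply/asboolP; exists 1; rewrite ?rpred1.
- by apply/asboolP/asboolP => -[u uS e]; exists u.
move=> /asboolP[u uS e] /asboolP[v vS f]; apply/asboolP.
exists (u * v * den y); first by rewrite !rpredM // (valP y.2).
transitivity (v * den z * (u * (num x * den y))); first by ring.
rewrite e; transitivity (u * den x * (v * (num y * den z))); first by ring.
by rewrite f; ring.
Qed.

Canonical equiv_equiv := EquivRelPack equiv_is_equiv.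
Canonical equiv_encModRel := defaultEncModRel equiv.

Definition type := {eq_quot equiv}.
HB.instance Definition _ : EqQuotient pre equiv type := EqQuotient.on type.
HB.instance Definition _ := Choice.on type.

Definition den1 : {x : R | x \in S} := exist _ 1 (rpred1 S).
Definition denM (s t : {x : R | x \in S}) : {x : R | x \in S} :=
  exist _ (sval s * sval t) (rpredM (valP s) (valP t)).

Definition addp x y : pre := (num x * den y + num y * den x, denM x.2 y.2).
Definition oppp x : pre := (- num x, x.2).
Definition mulp x y : pre := (num x * num y, denM x.2 y.2).

Definition frac (a : R) (s : {x : R | x \in S}) : type := \pi_type ((a, s) : pre).
Definition zero : type := frac 0 den1.
Definition one : type := frac 1 den1.
Definition add := lift_op2 type addp.
Definition opp := lift_op1 type oppp.
Definition mul := lift_op2 type mulp.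

Lemma eq_pi x y :
  reflect (exists2 u, u \in S & u * (num x * den y) = u * (num y * den x))
          (\pi_type x == \pi_type y).
Proof. by rewrite piE; apply: asboolP. Qed.

Lemma eq_pi1 x y : num x * den y = num y * den x -> \pi_type x = \pi_type y.
Proof. by move=> e; apply/eqP/eq_pi; exists 1; rewrite ?rpred1 ?e. Qed.

Lemma pi_repr x : exists2 u, u \in S &
  u * (num (repr (\pi_type x)) * den x) = u * (num x * den (repr (\pi_type x))).
Proof. by apply/eq_pi; rewrite reprK. Qed.

Lemma pi_add : {morph \pi : x y / addp x y >-> add x y}.
Proof.
move=> x y; unlock add; apply/eqP; rewrite eq_sym; apply/eq_pi.
have [u uS] := pi_repr x; have [v vS] := pi_repr y.
set y' := repr _; set x' := repr _ => f e.
exists (u * v); rewrite ?rpredM //=.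
transitivity (v * den y' * den y * (u * (num x' * den x))
  + u * den x' * den x * (v * (num y' * den y))); first by ring.
by rewrite e f; ring.
Qed.

Lemma pi_opp : {morph \pi : x / oppp x >-> opp x}.
Proof.
move=> x; unlock opp; apply/eqP; rewrite eq_sym; apply/eq_pi.
have [u uS e] := pi_repr x; exists u => //=.
by rewrite !mulNr !mulrN e.
Qed.

Lemma pi_mul : {morph \pi : x y / mulp x y >-> mul x y}.
Proof.
move=> x y; unlock mul; apply/eqP; rewrite eq_sym; apply/eq_pi.
have [u uS] := pi_repr x; have [v vS] := pi_repr y.
set y' := repr _; set x' := repr _ => f e.
exists (u * v); rewrite ?rpredM //=.
transitivity ((u * (num x' * den x)) * (v * (num y' * den y))); first by ring.
by rewrite e f; ring.
Qed.

Lemma addA : associative add.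
Proof.
elim/quotW=> x; elim/quotW=> y; elim/quotW=> z.
by rewrite -!pi_add; apply: eq_pi1 => /=; ring.
Qed.

Lemma addC : commutative add.
Proof.
elim/quotW=> x; elim/quotW=> y.
by rewrite -!pi_add; apply: eq_pi1 => /=; ring.
Qed.

Lemma add0 : left_id zero add.
Proof.
by elim/quotW=> x; rewrite -pi_add; apply: eq_pi1 => /=; ring.
Qed.

Lemma addN : left_inverse zero opp add.
Proof.
by elim/quotW=> x; rewrite -pi_opp -pi_add; apply: eq_pi1 => /=; ring.
Qed.

HB.instance Definition _ := GRing.isZmodule.Build type addA addC add0 addN.

Lemma mulA : associative mul.
Proof.
elim/quotW=> x; elim/quotW=> y; elim/quotW=> z.
by rewrite -!pi_mul; apply: eq_pi1 => /=; ring.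
Qed.

Lemma mulC : commutative mul.
Proof.
elim/quotW=> x; elim/quotW=> y.
by rewrite -!pi_mul; apply: eq_pi1 => /=; ring.
Qed.

Lemma mul1 : left_id one mul.
Proof.
by elim/quotW=> x; rewrite -pi_mul; apply: eq_pi1 => /=; ring.
Qed.

Lemma mulD : left_distributive mul add.
Proof.
elim/quotW=> x; elim/quotW=> y; elim/quotW=> z.
by rewrite -pi_add -!pi_mul -pi_add; apply: eq_pi1 => /=; ring.
Qed.

HB.instance Definition _ := GRing.Zmodule_isComPzRing.Build type mulA mulC mul1 mulD.

Definition to_loc (a : R) : type := frac a den1.

Lemma to_loc_zmod_morphism : zmod_morphism to_loc.
Proof.
move=> a b; rewrite /to_loc /frac -[LHS]/(\pi_type _).
rewrite -[RHS]/(add (\pi _) (opp (\pi _))) -pi_opp -pi_add.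
by apply: eq_pi1 => /=; ring.
Qed.

Lemma to_loc_monoid_morphism : monoid_morphism to_loc.
Proof.
split=> // a b; rewrite -[RHS]/(mul (\pi _) (\pi _)) -pi_mul.
by apply: eq_pi1 => /=; ring.
Qed.

HB.instance Definition _ :=
  GRing.isZmodMorphism.Build R type to_loc to_loc_zmod_morphism.
HB.instance Definition _ :=
  GRing.isMonoidMorphism.Build R type to_loc to_loc_monoid_morphism.

Lemma fracE a s : frac a s * to_loc (sval s) = to_loc a.
Proof.
rewrite -[LHS]/(mul (\pi _) (\pi _)) -pi_mul.
by apply: eq_pi1 => /=; ring.
Qed.

Lemma fracP (x : type) : exists a s, x = frac a s.
Proof. by elim/quotW: x => -[a s]; exists a, s. Qed.

Lemma to_loc_eq a b :
  to_loc a = to_loc b <-> exists2 u, u \in S & u * a = u * b.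
Proof.
split=> [/eqP/eq_pi[u uS]|[u uS e]]; first by rewrite /= !mulr1; exists u.
by apply/eqP/eq_pi; exists u; rewrite ?mulr1.
Qed.

End Localization.
End Localization.
HB.export Localization.

(* Localization of R inverting the elements of s. *)
Definition localize (R : comPzRingType) (s : seq R) : comPzRingType :=
  Localization.type (powers_of s : mulrClosed R).

Definition to_localize (R : comPzRingType) (s : seq R) : R -> localize s :=
  @Localization.to_loc R (powers_of s : mulrClosed R).

Definition localize_inv (R : comPzRingType) (s : seq R) (x : R) (xs : x \in s) :
    localize s :=
  @Localization.frac R (powers_of s : mulrClosed R) 1
    (exist _ x (mem_powers_of xs)).

Lemma localize_invP (R : comPzRingType) (s : seq R) (x : R) (xs : x \in s) :
  localize_inv xs * to_localize s x = 1.
Proof. exact: Localization.fracE. Qed.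

(* A Z-subalgebra is the same thing as a subring. *)
Definition generates_Zalg (R : comPzRingType) (s : seq R) : Prop :=
  forall P : {pred R}, subring_closed P -> {subset s <= P} -> forall x, x \in P.

Definition Z2 : zmodType := (int * int)%type.

Definition inverted : seq Z2 := [:: (1, 1); (1, 0); (0, 1)].

Definition net_ring_loc : comPzRingType :=
  localize (map (@net_var Z2) inverted).

Definition T (v : Z2) : net_ring_loc := to_localize _ (net_var v).

(* The inverse of T v as the fraction 1 / T v. *)
Definition Tinv (v : Z2) (vi : v \in inverted) : net_ring_loc :=
  localize_inv (map_f (@net_var Z2) vi).
Arguments Tinv v vi : clear implicits.

(* Main.v *)
Require Import Defs.
From HB Require Import structures.
From mathcomp Require Import all_boot all_order all_algebra.
From mathcomp Require Import ring zify boolp finmap monalg.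

Set Implicit Arguments.
Unset Strict Implicit.
Unset Printing Implicit Defensive.

Import Order.TTheory GRing.Theory Num.Theory.
Local Open Scope ring_scope.
Local Open Scope quotient_scope.

(** In a reduced ring an elliptic net is odd, because W(v)^3 (W(v) + W(-v)) = 0
    is an instance of the net equation.  With oddness, two instances of the net
    equation become recursions that express a value at v through values at
    points close to v/2:
    - [net_odd_double] expresses W(2w + u) W(u) W(u')^2 through the values at
      w, w + u, w +- u' and w + u +- u';
    - [net_double] expresses W(2w) W(u + u') W(u) W(u') through the values at
      w, w +- u, w +- u', w + u + u' and w - u - u'.

    In the plane lattice, (1,0), (0,1) and (1,1) represent the three nonzero
    classes modulo 2.  So one of the two recursions applies to every v with u
    and u' among these three vectors, and then the factor in front of the value
    at v is a product of values at these vectors.  When those values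
    are invertible inside a subring P, membership in P passes from points near
    v/2 to v.  Every point used is x = (v + t)/2 with t short.  By the
    parallelogram law x is shorter than v as soon as t is not longer than v and
    differs from it, and so induction on the Euclidean norm leaves only the
    vectors of squared norm at most 8 and +-(1,3).  For these the recursions,
    applied in a suitable order, start from the eight given values.  This is
    [net_mem]: a subring that contains the eight given values and the three
    inverses contains all values of the net.

    Everything follows from [net_mem], applied to three subrings.  For the
    universal net T, in a localization of a reduced ring, it gives the
    generation statement.  For a rational net and the subring of integers it
    gives integrality.  For a pair (W', W) of rational nets, seen as one net with
    values in Q x Q, and the diagonal subring, it gives uniqueness.  The two
    displayed identities are themselves instances of the recursions; for rational
    nets the second one computes W(2,2), since W(1,-1) = W(1,2) - W(2,1) is not
    zero. *)

(** * Recursions in an elliptic net *)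

Definition reduced (R : comPzRingType) : Prop :=
  forall (x : R) (n : nat), x ^+ n = 0 -> x = 0.

Section NetIdentities.
Variables (A : zmodType) (R : comPzRingType) (W : A -> R).
Hypotheses (redR : reduced R) (W0 : W 0 = 0).
Hypothesis netW : forall p q r s, net_expr W p q r s = 0.

(** The equation with p = q = v and r = s = 0 gives W(v)^3 (W(v) + W(-v)) = 0,
    and the same with -v for v.  Every monomial of (W(v) + W(-v))^5 contains a
    cube, hence W(v) + W(-v) is nilpotent. *)
Lemma net_odd v : W (- v) = - W v.
Proof.
have cube u : W u ^+ 3 * (W u + W (- u)) = 0.
  have := netW u u 0 0; rewrite /net_expr W0 !subrr !sub0r !add0r !subr0 !addr0.
  by move=> <-; rewrite W0; ring.
apply/eqP; rewrite -addr_eq0 addrC; apply/eqP/(redR (n := 6)).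
have e := cube v; have := cube (- v); rewrite opprK => f.
transitivity
  ((W v ^+ 2 + 5 * W v * W (- v) + 10 * W (- v) ^+ 2)
     * (W v ^+ 3 * (W v + W (- v)))
   + (10 * W v ^+ 2 + 5 * W v * W (- v) + W (- v) ^+ 2)
     * (W (- v) ^+ 3 * (W (- v) + W v))); first by ring.
by rewrite e f !mulr0 addr0.
Qed.

(** The net equation at p = w + u, q = w, r = u', s = 0. *)
Lemma net_odd_double w u u' :
  W (w + w + u) * (W u * W u' ^+ 2)
  = W (w + u + u') * W (w + u - u') * W w ^+ 2
  - W (w + u') * W (w - u') * W (w + u) ^+ 2.
Proof.
have := netW (w + u) w u' 0; rewrite /net_expr !addr0.
have -> : w + u + w = w + w + u by rewrite addrAC.
have -> : w + u - w = u by rewrite addrC addKr.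
rewrite -(opprB (w + u) u') net_odd (addrC u' (w + u)) => e.
by apply/eqP; rewrite -subr_eq0; apply/eqP; rewrite -e; ring.
Qed.

(** The net equation at p = w + u, q = w - u', r = u, s = u' - u. *)
Lemma net_double w u u' :
  W (w + w) * (W (u + u') * W u * W u')
  = W w * (W (w + u + u') * W (w - u) * W (w - u')
           - W (w - u - u') * W (w + u) * W (w + u')).
Proof.
have := netW (w + u) (w - u') u (u' - u); rewrite /net_expr.
have telescope : w - u' + (u' - u) = w - u by rewrite addrA subrK.
have -> : w + u + (w - u') + (u' - u) = w + w.
  by rewrite -addrA telescope addrACA subrr addr0.
have -> : w + u - (w - u') = u + u' by rewrite opprB addrC addrA subrK addrC.
have -> : u + (u' - u) = u' by rewrite addrC subrK.
have -> : w - u' + u + (u' - u) = w by rewrite addrAC telescope subrK.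
have -> : w + u + (u' - u) = w + u' by rewrite -addrA [u + _]addrC subrK.
have -> : u + (w + u) + (u' - u) = w + u + u'.
  by rewrite addrAC [u + _]addrC subrK addrC.
rewrite telescope.
have -> : u - (w + u) = - w by rewrite opprD addrCA subrr addr0.
have -> : w - u' - u = w - u - u' by rewrite addrAC.
rewrite net_odd => e.
by apply/eqP; rewrite -subr_eq0; apply/eqP; rewrite -e; ring.
Qed.

End NetIdentities.

(** * Vectors of the plane lattice *)

Definition sqnorm (v : Z2) : int := v.1 * v.1 + v.2 * v.2.

(** By the parallelogram law, |2x|^2 + |v - t|^2 = 2 |v|^2 + 2 |t|^2. *)
Lemma sqnorm_halve (x v t : Z2) :
  x + x = v + t -> sqnorm t <= sqnorm v -> t != v -> 0 <= sqnorm x < sqnorm v.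
Proof.
case: x v t => [x1 x2] [v1 v2] [t1 t2]; rewrite /sqnorm /= => -[e1 e2] le_tv.
rewrite xpair_eqE => neq_tv.
have t1E : t1 = x1 + x1 - v1 by rewrite e1 addrC addKr.
have t2E : t2 = x2 + x2 - v2 by rewrite e2 addrC addKr.
have ge0 z : 0 <= z * z :> int by nia.
have gt0 : 0 < (v1 - t1) * (v1 - t1) + (v2 - t2) * (v2 - t2).
  have pos z : z != 0 -> 0 < z * z :> int by nia.
  case/nandP: neq_tv => neq.
    by apply: ltr_wpDr => //; apply: pos; lia.
  by apply: ltr_wpDl => //; apply: pos; lia.
rewrite addr_ge0 ?ge0 //=.
rewrite t1E t2E in le_tv gt0; lia.
Qed.

(** One vector out of each pair of opposite vectors of squared norm at most 8. *)
Definition short_vectors : seq Z2 :=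
  [:: (0, 0); (1, 0); (0, 1); (1, 1); (1, -1); (2, 0); (0, 2);
      (2, 1); (1, 2); (2, -1); (1, -2); (2, 2); (2, -2)].

Lemma short_vectorP u :
  sqnorm u <= 8 -> (u \in short_vectors) || (- u \in short_vectors).
Proof.
case: u => m n; rewrite /sqnorm /= => le8.
have bound (z t : int) : z * z + t * t <= 8 -> -2 <= z <= 2 by nia.
have m2 := bound _ _ le8; rewrite addrC in le8; have n2 := bound _ _ le8.
have [->|[->|[->|[->|->]]]] :
  m = -2 \/ m = -1 \/ m = 0 \/ m = 1 \/ m = 2 by lia.
all: have [->|[->|[->|[->|->]]]] :
  n = -2 \/ n = -1 \/ n = 0 \/ n = 1 \/ n = 2 by lia.
all: by [].
Qed.

Lemma halving_ind (Q : Z2 -> Prop) :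
  (forall v, sqnorm v <= 8 -> Q v) ->
  (forall v, 8 < sqnorm v ->
     (forall x t, x + x = v + t -> sqnorm t <= sqnorm v -> t != v -> Q x) ->
     Q v) ->
  forall v, Q v.
Proof.
move=> base step v; have [N] := ubnP `|sqnorm v|%N.
elim: N v => // N IHN v ltN; have [/base//|gt8] := lerP (sqnorm v) 8.
apply: step => // x t xxE le_tv neq_tv; apply: IHN.
by have := sqnorm_halve xxE le_tv neq_tv; lia.
Qed.

Lemma Z2_eq (x y : Z2) : x.1 = y.1 -> x.2 = y.2 -> x = y.
Proof. by case: x y => [x1 x2] [y1 y2] /= -> ->. Qed.

Lemma Z2_parity (v : Z2) : exists a b : int,
  v = (a, b) + (a, b) \/ v = (a, b) + (a, b) + (1, 0) \/
  v = (a, b) + (a, b) + (0, 1) \/ v = (a, b) + (a, b) + (1, 1).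
Proof.
have parity (m : int) : exists k, m = k + k \/ m = k + k + 1.
  by exists (m %/ 2)%Z; lia.
case: v => m n; have [a aE] := parity m; have [b bE] := parity n.
exists a, b; case: aE => ->; case: bE => ->.
- by left.
- by right; right; left; rewrite -[in LHS](addr0 (a + a)).
- by right; left; rewrite -[in LHS](addr0 (b + b)).
- by right; right; right.
Qed.

(** A sum of two odd squares is 2 modulo 8, so that it skips 9. *)
Lemma sqnorm_odd (v : Z2) (a b : int) :
  v = (a, b) + (a, b) + (1, 1) -> 8 < sqnorm v -> 10 <= sqnorm v.
Proof. by move=> ->; rewrite /sqnorm /=; lia. Qed.

(** * A subring containing finitely many values contains them all *)

Definition inv_in (R : comPzRingType) (P : {pred R}) (u : R) : Prop :=
  exists2 y, y \in P & y * u = 1.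

Lemma inv_inM (R : comPzRingType) (P : subringClosed R) u v :
  inv_in P u -> inv_in P v -> inv_in P (u * v).
Proof.
move=> [y yP yu] [z zP zv]; exists (y * z); first exact: rpredM.
by rewrite mulrACA yu zv mulr1.
Qed.

Lemma mem_cancel (R : comPzRingType) (P : subringClosed R) u x :
  inv_in P u -> x * u \in P -> x \in P.
Proof.
by move=> [y yP yu] xuP; rewrite -[x]mulr1 -yu [y * u]mulrC mulrA rpredM.
Qed.

Section PlaneNet.
Variables (R : comPzRingType) (W : Z2 -> R) (P : subringClosed R).
Hypotheses (redR : reduced R) (W0 : W 0 = 0).
Hypothesis netW : forall p q r s, net_expr W p q r s = 0.

Let Wodd := net_odd redR W0 netW.
Let Wstep := net_odd_double redR W0 netW.
Let Wdouble := net_double redR W0 netW.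

(** The odd recursion at w = (0,-1), u = u' = (1,1). *)
Lemma net_W1N1 :
  W (1, -1) * W (1, 1) ^+ 3
  = W (1, 0) ^+ 3 * W (1, 2) - W (0, 1) ^+ 3 * W (2, 1).
Proof.
have e : W (1, -1) * (W (1, 1) * W (1, 1) ^+ 2)
    = W (2, 1) * W (0, -1) * W (0, -1) ^+ 2
    - W (1, 0) * W (- (1, 2)) * W (1, 0) ^+ 2 := Wstep (0, -1) (1, 1) (1, 1).
have f : W (0, -1) = - W (0, 1) := Wodd (0, 1).
by rewrite -exprS in e; rewrite e Wodd f; ring.
Qed.

(** The doubling recursion at w = (1,1), u = (1,0), u' = (0,-1). *)
Lemma net_W22 :
  W (2, 2) * W (1, -1) * W (1, 0) * W (0, 1)
  = W (1, 1) * (W (0, 2) * W (2, 1) * W (1, 0)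
                - W (0, 1) * W (2, 0) * W (1, 2)).
Proof.
have e : W (2, 2) * (W (1, -1) * W (1, 0) * W (- (0, 1)))
    = W (1, 1) * (W (2, 0) * W (0, 1) * W (1, 2) - W (0, 2) * W (2, 1) * W (1, 0))
  := Wdouble (1, 1) (1, 0) (0, -1).
have {e} := congr1 -%R e; rewrite Wodd => e.
transitivity (- (W (2, 2) * (W (1, -1) * W (1, 0) * - W (0, 1)))); first by ring.
by rewrite e; ring.
Qed.

Hypothesis memP : {in [:: (1, 1); (1, 0); (0, 1); (2, 1); (1, 2); (2, 0); (0, 2);
  (2, 2)] : seq Z2, forall v, W v \in P}.
Hypothesis invP : {in inverted, forall v, inv_in P (W v)}.

(** Induction on the norm of v, halving v with the recursion that fits its class
    modulo 2.  The short vectors are treated one by one, in an order in which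
    each recursion only calls values already obtained. *)
Lemma net_mem v : W v \in P.
Proof.
have WN u : W u \in P -> W (- u) \in P by rewrite Wodd rpredN.
have i11 : inv_in P (W (1, 1)) by exact: invP.
have i10 : inv_in P (W (1, 0)) by exact: invP.
have i01 : inv_in P (W (0, 1)) by exact: invP.
have m11 : W (1, 1) \in P by exact: memP.
have m10 : W (1, 0) \in P by exact: memP.
have m01 : W (0, 1) \in P by exact: memP.
have m21 : W (2, 1) \in P by exact: memP.
have m12 : W (1, 2) \in P by exact: memP.
have m20 : W (2, 0) \in P by exact: memP.
have m02 : W (0, 2) \in P by exact: memP.
have m22 : W (2, 2) \in P by exact: memP.
have odd_mem w u u' : inv_in P (W u) -> inv_in P (W u') ->
    W (w + u + u') \in P -> W (w + u - u') \in P -> W w \in P ->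
    W (w + u') \in P -> W (w - u') \in P -> W (w + u) \in P ->
    W (w + w + u) \in P.
  move=> iu iu' *; apply: (@mem_cancel _ _ (W u * W u' ^+ 2)).
    by rewrite expr2; do !apply: inv_inM.
  by rewrite Wstep rpredB ?rpredM ?rpredX.
have double_mem w :
    W (w + (1, 1)) \in P -> W (w - (1, 1)) \in P ->
    W (w - (1, 0)) \in P -> W (w - (0, 1)) \in P -> W w \in P ->
    W (w + (1, 0)) \in P -> W (w + (0, 1)) \in P -> W (w + w) \in P.
  move=> *; apply: (@mem_cancel _ _ (W (1, 1) * W (1, 0) * W (0, 1))).
    by do !apply: inv_inM.
  rewrite -[(1, 1)]/((1, 0) + (0, 1) : Z2) Wdouble -!addrA -opprD.
  by rewrite rpredM ?rpredB ?rpredM.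
have m1N1 : W (1, -1) \in P.
  apply: (@mem_cancel _ _ (W (1, 1) ^+ 3)); last first.
    by rewrite net_W1N1 rpredB ?rpredM ?rpredX.
  by rewrite exprS expr2; do !apply: inv_inM.
have m00 : W (0, 0) \in P by rewrite W0 rpred0.
have mN10 : W (-1, 0) \in P := WN (1, 0) m10.
have m0N1 : W (0, -1) \in P := WN (0, 1) m01.
have mN1N2 : W (-1, -2) \in P := WN (1, 2) m12.
have m0N2 : W (0, -2) \in P := WN (0, 2) m02.
have m2N1 : W (2, -1) \in P :=
  odd_mem (1, -1) (0, 1) (1, 1) i01 i11 m21 m0N1 m1N1 m20 m0N2 m10.
have m1N2 : W (1, -2) \in P :=
  odd_mem (0, -1) (1, 0) (1, 1) i10 i11 m20 m0N2 m0N1 m10 mN1N2 m1N1.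
have m2N2 : W (2, -2) \in P :=
  double_mem (1, -1) m20 m0N2 m0N1 m1N2 m1N1 m2N1 m10.
(* Here u' = (1,0): with u' = (0,1) the recursion for W(1,3) calls W(1,3). *)
have m13 : W (1, 3) \in P.
  have mN11 : W (-1, 1) \in P := WN (1, -1) m1N1.
  exact: (odd_mem (0, 1) (1, 1) (1, 0) i11 i10 m22 m02 m01 m11 mN11 m12).
have small_mem : {in short_vectors, forall u, W u \in P}.
  apply/allP; rewrite /= m00 m10 m01 m11 m1N1 m20 m02 m21 m12.
  by rewrite m2N1 m1N2 m22 m2N2.
have le8_mem u : sqnorm u <= 8 -> W u \in P.
  by case/short_vectorP/orP=> /small_mem // /WN; rewrite opprK.
elim/halving_ind: v => [v /le8_mem//|v gt8 IH].
(* The induction hypothesis is used at x = (v + t)/2; in each case below the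
   displayed vector is t = 2x - v. *)
have IH8 x t : x + x = v + t -> sqnorm t <= 8 -> W x \in P.
  move=> xxE le8; have lt_tv : sqnorm t < sqnorm v by apply: le_lt_trans gt8.
  apply: (IH _ _ xxE); first exact: ltW.
  by apply: contraTneq lt_tv => ->; rewrite ltxx.
have [a [b [vE|[vE|[vE|vE]]]]] := Z2_parity v.
- rewrite vE; apply: double_mem.
  + by apply: (IH8 _ (2, 2)); rewrite ?vE //; apply: Z2_eq => /=; ring.
  + by apply: (IH8 _ (-2, -2)); rewrite ?vE //; apply: Z2_eq => /=; ring.
  + by apply: (IH8 _ (-2, 0)); rewrite ?vE //; apply: Z2_eq => /=; ring.
  + by apply: (IH8 _ (0, -2)); rewrite ?vE //; apply: Z2_eq => /=; ring.
  + by apply: (IH8 _ (0, 0)); rewrite ?vE //; apply: Z2_eq => /=; ring.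
  + by apply: (IH8 _ (2, 0)); rewrite ?vE //; apply: Z2_eq => /=; ring.
  + by apply: (IH8 _ (0, 2)); rewrite ?vE //; apply: Z2_eq => /=; ring.
- rewrite vE; apply: (odd_mem _ _ (0, 1)) => //.
  + by apply: (IH8 _ (1, 2)); rewrite ?vE //; apply: Z2_eq => /=; ring.
  + by apply: (IH8 _ (1, -2)); rewrite ?vE //; apply: Z2_eq => /=; ring.
  + by apply: (IH8 _ (-1, 0)); rewrite ?vE //; apply: Z2_eq => /=; ring.
  + by apply: (IH8 _ (-1, 2)); rewrite ?vE //; apply: Z2_eq => /=; ring.
  + by apply: (IH8 _ (-1, -2)); rewrite ?vE //; apply: Z2_eq => /=; ring.
  + by apply: (IH8 _ (1, 0)); rewrite ?vE //; apply: Z2_eq => /=; ring.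
- rewrite vE; apply: (odd_mem _ _ (1, 0)) => //.
  + by apply: (IH8 _ (2, 1)); rewrite ?vE //; apply: Z2_eq => /=; ring.
  + by apply: (IH8 _ (-2, 1)); rewrite ?vE //; apply: Z2_eq => /=; ring.
  + by apply: (IH8 _ (0, -1)); rewrite ?vE //; apply: Z2_eq => /=; ring.
  + by apply: (IH8 _ (2, -1)); rewrite ?vE //; apply: Z2_eq => /=; ring.
  + by apply: (IH8 _ (-2, -1)); rewrite ?vE //; apply: Z2_eq => /=; ring.
  + by apply: (IH8 _ (0, 1)); rewrite ?vE //; apply: Z2_eq => /=; ring.
(* In the class of (1,1) the choice u' = (0,1) leads to t = (1,3) and
   t = -(1,3), where the recursion would return to v itself if v = t. *)
have [-> //|neq13] := eqVneq v (1, 3).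
have [-> |neqN13] := eqVneq v (- (1, 3)); first exact: WN.
have IH10 x t : x + x = v + t -> sqnorm t = 10 -> t != v -> W x \in P.
  move=> xxE t10; apply: IH xxE _.
  by rewrite t10; apply: sqnorm_odd vE gt8.
rewrite vE; apply: (odd_mem _ _ (0, 1)) => //.
- apply: (IH10 _ (1, 3)); rewrite // 1?eq_sym //.
  by rewrite vE; apply: Z2_eq => /=; ring.
- by apply: (IH8 _ (1, -1)); rewrite ?vE //; apply: Z2_eq => /=; ring.
- by apply: (IH8 _ (-1, -1)); rewrite ?vE //; apply: Z2_eq => /=; ring.
- by apply: (IH8 _ (-1, 1)); rewrite ?vE //; apply: Z2_eq => /=; ring.
- apply: (IH10 _ (- (1, 3))); rewrite // 1?eq_sym //.
  by rewrite vE; apply: Z2_eq => /=; ring.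
- by apply: (IH8 _ (1, 1)); rewrite ?vE //; apply: Z2_eq => /=; ring.
Qed.
End PlaneNet.

(** * The universal net ring is reduced *)

Lemma reduced_quot_reduced (R : comNzRingType) : reduced (reduced_quot R).
Proof.
move=> x n; rewrite -[x]reprK; move: (repr x) => y.
pose pi : {rmorphism R -> reduced_quot R} :=
  \pi_{ideal_quot (nilradical R : idealr R)}.
have pi_eq0 z : (pi z == 0) = (z \in nilradical R).
  by rewrite -(rmorph0 pi) -Quotient.idealrBE subr0.
rewrite -rmorphXn => /eqP; rewrite pi_eq0 => /asboolP[m ym].
apply/eqP; rewrite pi_eq0; apply/asboolP; exists (n * m)%N.
by rewrite exprM.
Qed.

Lemma frac_inv (R : comPzRingType) (S : mulrClosed R) u :
  Localization.frac 1 u * Localization.to_loc S (sval u) = 1.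
Proof. by rewrite Localization.fracE rmorph1. Qed.

(** If (a/u)^n = 0 then w a^n = 0 for some w in S, hence w a is nilpotent. *)
Lemma localization_reduced (R : comPzRingType) (S : mulrClosed R) :
  reduced R -> reduced (Localization.type S).
Proof.
move=> redR x n xn0; have [a [u xE]] := Localization.fracP x.
have aE : Localization.to_loc S a = x * Localization.to_loc S (sval u).
  by rewrite xE Localization.fracE.
have : Localization.to_loc S (a ^+ n) = Localization.to_loc S 0.
  by rewrite rmorphXn /= aE exprMn xn0 mul0r rmorph0.
case/Localization.to_loc_eq=> w wS; rewrite mulr0 => wan0.
have wa0 : w * a = 0.
  apply: (redR _ n.+1).
  transitivity (w ^+ n * a * (w * a ^+ n)); first by rewrite exprMn !exprS; ring.
  by rewrite wan0 mulr0.
have a0 : Localization.to_loc S a = 0.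
  rewrite -(rmorph0 (Localization.to_loc S)); apply/Localization.to_loc_eq.
  by exists w; rewrite // wa0 mulr0.
rewrite -[x]mulr1 -(frac_inv u) [_ * Localization.to_loc _ _]mulrC mulrA -aE a0.
exact: mul0r.
Qed.

Lemma net_ring_loc_reduced : reduced net_ring_loc.
Proof. exact/localization_reduced/reduced_quot_reduced. Qed.

(** * The universal net and its generators *)

Lemma net_quot_gen f : net_gen f -> \pi_(net_quot Z2) f = 0.
Proof.
move=> genf; apply/eqP; rewrite -(rmorph0 \pi_(net_quot Z2)) -Quotient.idealrBE subr0.
apply/asboolP; exists [:: (1, f)]; last by rewrite big_seq1 mul1r.
by move=> c; rewrite inE => /eqP->.
Qed.

Definition poly_val : {rmorphism poly_ring Z2 -> net_ring_loc} :=
  Localization.to_loc (powers_of (map (@net_var Z2) inverted))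
  \o \pi_(net_ring Z2) \o \pi_(net_quot Z2).

Lemma T0 : T 0 = 0.
Proof.
rewrite -[T 0]/(poly_val (poly_var 0)) /= net_quot_gen; last by left.
by rewrite !rmorph0.
Qed.

Lemma T_net p q r s : net_expr T p q r s = 0.
Proof.
rewrite -[LHS](rmorph_net_expr poly_val) /= net_quot_gen ?rmorph0 //.
by right; exists p, q, r, s.
Qed.

Lemma monom_ind (I : choiceType) (Q : {cmonom I} -> Prop) :
  Q mone -> (forall i m, Q m -> Q (mmul (ucm i) m)) -> forall m, Q m.
Proof.
move=> Q1 QM m; have [n] := ubnP (mdeg m); elim: n m => // n IHn m lt_mn.
have [supp0|[i]] := fset_0Vmem (finsupp m).
  suff -> : m = mone by [].
  by apply/eqP/cmP => j; apply/eqP; rewrite cm1 cmE_eq0 supp0.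
rewrite -cmE_neq0 -lt0n => m_i_gt0.
have mE : m = mmul (ucm i) (divcm m (ucm i)).
  apply/eqP/cmP => j; rewrite cmM divcmE cmU subnKC //.
  by case: eqP => [<-|].
rewrite mE; apply: QM; apply: IHn.
by move: lt_mn; rewrite [in mdeg m]mE mdegM mdegU.
Qed.

(** The net ring is a quotient of a polynomial ring in the variables T_v. *)
Lemma poly_val_mem (P : subringClosed net_ring_loc) :
  (forall v, T v \in P) -> forall f, poly_val f \in P.
Proof.
move=> TP f; rewrite (monalgE f) rmorph_sum rpred_sum // => m _.
have -> : << f@_m *g m >> = << m >> *~ f@_m :> poly_ring Z2.
  by rewrite -[in LHS](intz f@_m) -raddfMz.
rewrite rmorphMz rpredMz //; elim/monom_ind: m => [|i m IHm].
  by rewrite rmorph1 rpred1.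
have -> : << mmul (ucm i) m >> = poly_var i * << m >>.
  by rewrite /poly_var malgM_def fgmulUU mulr1.
have -> : poly_val (poly_var i * << m >>) = T i * poly_val << m >>.
  exact: (rmorphM poly_val).
exact: rpredM (TP i) IHm.
Qed.

Lemma localize_mem (R : comPzRingType) (s : seq R) (P : subringClosed (localize s)) :
  (forall a, to_localize s a \in P) ->
  (forall x (xs : x \in s), localize_inv xs \in P) ->
  forall y, y \in P.
Proof.
move=> numP invP y; have [a [u yE]] := Localization.fracP y.
apply: (@mem_cancel _ P (to_localize s (sval u))); last first.
  by rewrite yE /to_localize Localization.fracE numP.
case: u {yE} => _ /= /asboolP[e ->]; rewrite /to_localize rmorph_prod.
elim/big_rec: _ => [|i z _ iz]; first by exists 1; rewrite ?rpred1 ?mulr1.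
apply: inv_inM iz; rewrite rmorphXn /=; elim: (e i) => [|n IHn].
  by exists 1; rewrite ?rpred1 ?mulr1.
rewrite exprS; apply: inv_inM IHn.
have si : s`_i \in s by rewrite mem_nth.
by exists (localize_inv si); [exact: invP | exact: localize_invP].
Qed.

Lemma subring_pred (R : comPzRingType) (P : {pred R}) :
  subring_closed P -> {S : subringClosed R | P =i S}.
Proof.
move=> clP.
pose S : subringClosed R := HB.pack P (GRing.isSubringClosed.Build R P clP).
by exists S.
Qed.

Lemma net_ring_loc_generated :
  generates_Zalg
    [:: T (1, 1); T (1, 0); T (0, 1);
        Tinv (1, 1) isT; Tinv (1, 0) isT; Tinv (0, 1) isT;
        T (2, 1); T (1, 2); T (2, 0); T (0, 2); T (2, 2)].
Proof.
move=> Q /subring_pred[P QP] genQ x; rewrite QP.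
have {genQ} : {in [:: T (1, 1); T (1, 0); T (0, 1);
        Tinv (1, 1) isT; Tinv (1, 0) isT; Tinv (0, 1) isT;
        T (2, 1); T (1, 2); T (2, 0); T (0, 2); T (2, 2)],
    forall y, y \in P} by move=> y /genQ; rewrite QP.
case/forall_cons=> m11 /forall_cons[m10 /forall_cons[m01]].
case/forall_cons=> i11 /forall_cons[i10 /forall_cons[i01]].
case/forall_cons=> m21 /forall_cons[m12 /forall_cons[m20 /forall_cons[m02]]].
case/forall_cons=> m22 _.
have TinvP : {in inverted, forall v, forall vi : v \in inverted, Tinv v vi \in P}.
  apply/forall_cons; split=> [vi|].
    by rewrite (bool_irrelevance vi isT).
  apply/forall_cons; split=> [vi|].
    by rewrite (bool_irrelevance vi isT).
  apply/forall_cons; split=> [vi|//].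
  by rewrite (bool_irrelevance vi isT).
have TP v : T v \in P.
  apply: (net_mem net_ring_loc_reduced T0 T_net) => {v} [|v vi]; last first.
    by exists (Tinv v vi); [exact: TinvP | exact: localize_invP].
  apply/forall_cons; split; first exact: m11.
  apply/forall_cons; split; first exact: m10.
  apply/forall_cons; split; first exact: m01.
  apply/forall_cons; split; first exact: m21.
  apply/forall_cons; split; first exact: m12.
  apply/forall_cons; split; first exact: m20.
  apply/forall_cons; split; first exact: m02.
  apply/forall_cons; split; first exact: m22.
  by move=> y; rewrite in_nil; discriminate.
apply: localize_mem => [a|y ys].
  rewrite -[a]reprK -[repr a]reprK; exact: (poly_val_mem TP).
have /mapP[v vi yE] := ys; subst y.
by rewrite (bool_irrelevance ys (map_f _ vi)); apply: TinvP.
Qed.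

(** * Rational nets *)

Lemma idomain_reduced (R : idomainType) : reduced R.
Proof. by move=> x n /eqP; rewrite expf_eq0 => /andP[_ /eqP]. Qed.

Lemma prod_reduced (R S : comPzRingType) :
  reduced R -> reduced S -> reduced (R * S)%type.
Proof.
move=> redR redS [x y] n xyn0; congr pair.
  by apply: (redR _ n); rewrite -[x]/(fst (x, y)) -rmorphXn xyn0.
by apply: (redS _ n); rewrite -[y]/(snd (x, y)) -rmorphXn xyn0.
Qed.

Definition diagonal (R : comPzRingType) : {pred R * R} := fun x => x.1 == x.2.

Lemma diagonal_subring (R : comPzRingType) : subring_closed (@diagonal R).
Proof.
split=> [|x y /eqP xE /eqP yE|x y /eqP xE /eqP yE]; first exact: eqxx.
  by apply/eqP; rewrite /= xE yE.
by apply/eqP; rewrite /= xE yE.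
Qed.

HB.instance Definition _ (R : comPzRingType) :=
  GRing.isSubringClosed.Build _ (@diagonal R) (@diagonal_subring R).

Section RationalNet.
Variables (W : Z2 -> rat) (a b c d : int).
Hypotheses (netW : elliptic_net W).
Hypotheses (W10 : W (1, 0) = 1) (W01 : W (0, 1) = 1) (W11 : W (1, 1) = 1).
Hypotheses (W20 : W (2, 0) = a%:~R) (W02 : W (0, 2) = b%:~R).
Hypotheses (W12 : W (1, 2) = c%:~R) (W21 : W (2, 1) = d%:~R).
Hypothesis neq_cd : c != d.

Let W0 : W 0 = 0 := netW.1.
Let redQ := @idomain_reduced rat.

Lemma rat_net_W22 : W (2, 2) = (b * d - a * c)%:~R / (c - d)%:~R.
Proof.
have := net_W1N1 redQ W0 netW.2; have := net_W22 redQ W0 netW.2.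
rewrite W10 W01 W11 W20 W02 W12 W21 !expr1n !(mul1r, mulr1) => W22E W1N1.
rewrite W1N1 -!rmorphM -!rmorphB /= in W22E; rewrite -W22E mulfK //.
by rewrite intr_eq0 subr_eq0.
Qed.

Lemma rat_net_int : (c - d %| b * d - a * c)%Z -> forall v, W v \is a Num.int.
Proof.
move=> /dvdzP[e eE]; apply: (net_mem redQ W0 netW.2) => v.
  rewrite !inE; do ?[case/predU1P=> [->|] | move/eqP=> ->].
  all: rewrite ?(W10, W01, W11, W20, W02, W12, W21) ?rpred1 ?intr_int //.
  rewrite rat_net_W22 eE rmorphM mulfK ?intr_int //.
  by rewrite intr_eq0 subr_eq0.
have inv1 : inv_in Num.int (1 : rat) by exists 1; rewrite ?rpred1 ?mulr1.
by rewrite !inE => /or3P[]/eqP->; rewrite ?W10 ?W01 ?W11.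
Qed.
End RationalNet.

(** The pair (W', W) is a net with values in the reduced ring Q x Q, and the two
    nets agree where the value of the pair lies on the diagonal. *)
Lemma rat_net_unique (W W' : Z2 -> rat) (a b c d : int) :
  elliptic_net W -> elliptic_net W' ->
  W (1, 0) = 1 -> W (0, 1) = 1 -> W (1, 1) = 1 ->
  W (2, 0) = a%:~R -> W (0, 2) = b%:~R ->
  W (1, 2) = c%:~R -> W (2, 1) = d%:~R ->
  c != d ->
  {in [:: (1, 0); (0, 1); (1, 1); (2, 0); (0, 2); (1, 2); (2, 1)] : seq Z2,
     W' =1 W} ->
  W' =1 W.
Proof.
move=> netW netW' W10 W01 W11 W20 W02 W12 W21 neq_cd eqW.
have eqW22 : W' (2, 2) = W (2, 2).
  rewrite (rat_net_W22 netW W10 W01 W11 W20 W02 W12 W21 neq_cd).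
  by apply: (rat_net_W22 netW'); rewrite ?eqW.
pose V v : rat * rat := (W' v, W v).
have redQ2 : reduced (rat * rat)%type by apply: prod_reduced; exact: idomain_reduced.
have V0 : V 0 = 0 by rewrite /V netW.1 netW'.1.
have netV p q r s : net_expr V p q r s = 0.
  exact: congr2 (netW'.2 p q r s) (netW.2 p q r s).
move=> v; apply/eqP; rewrite -[_ == _]/(V v \in @diagonal rat).
apply: (net_mem redQ2 V0 netV) => {v} v vl.
  apply/eqP; rewrite /=; have [->//|neq22] := eqVneq v (2, 2).
  apply: eqW; move: vl; rewrite !inE (negPf neq22) orbF.
  by do ?[case/predU1P=> [->//|] | move/eqP=> ->].
exists 1; first exact: rpred1.
by move: vl; rewrite mul1r !inE /V => /or3P[]/eqP->; rewrite ?eqW // ?W10 ?W01 ?W11.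
Qed.

(** * The structure theorem *)

Theorem theorem2p5 :
  [/\ generates_Zalg
         [:: T (1, 1); T (1, 0); T (0, 1);
             Tinv (1, 1) isT; Tinv (1, 0) isT; Tinv (0, 1) isT;
             T (2, 1); T (1, 2); T (2, 0); T (0, 2); T (2, 2)],
      T (1, -1) * T (1, 1) ^+ 3
        = T (1, 0) ^+ 3 * T (1, 2) - T (0, 1) ^+ 3 * T (2, 1),
      T (2, 2) * T (1, -1) * T (1, 0) * T (0, 1)
        = T (1, 1) * (T (0, 2) * T (2, 1) * T (1, 0)
                      - T (0, 1) * T (2, 0) * T (1, 2))
    & forall (W : Z2 -> rat) (a b c d : int),
        elliptic_net W ->
        W (1, 0) = 1 -> W (0, 1) = 1 -> W (1, 1) = 1 ->
        W (2, 0) = a%:~R -> W (0, 2) = b%:~R ->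
        W (1, 2) = c%:~R -> W (2, 1) = d%:~R ->
        c != d ->
        (c - d %| b * d - a * c)%Z ->
        (forall W' : Z2 -> rat,
           elliptic_net W' ->
           {in [:: (1, 0); (0, 1); (1, 1); (2, 0); (0, 2); (1, 2); (2, 1)] : seq Z2,
             W' =1 W} ->
           W' =1 W)
        /\ (forall v : Z2, W v \is a Num.int)].
Proof.
split.
- exact: net_ring_loc_generated.
- exact: net_W1N1 net_ring_loc_reduced T0 T_net.
- exact: net_W22 net_ring_loc_reduced T0 T_net.
move=> W a b c d netW W10 W01 W11 W20 W02 W12 W21 neq_cd dvd_cd; split.
  by move=> W' netW'; apply: (rat_net_unique netW netW' W10 W01 W11 W20 W02 W12 W21).
exact: (rat_net_int netW W10 W01 W11 W20 W02 W12 W21).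
Qed.
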